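(* As linear maps $\mathcal H_{CK}\to\mathcal H\otimes\mathcal H_{CK}\otimes\mathcal H_{CK}$, $$(\mathrm{Id}_{\mathcal H}\otimes\Delta_{CK})\circ\Phi=m^{1,3}\circ(\Phi\otimes\Phi)\circ\Delta_{CK},$$ where $m^{1,3}(a\otimes b\otimes c\otimes d)=ac\otimes b\otimes d$ for $a,c\in\mathcal H$, $b,d\in\mathcal H_{CK}$.
   Context: Let $k$ be a field of characteristic $0$. Rooted trees are finite and non-planar; $\bullet$ denotes the one-vertex tree. (1) Let $\mathcal H$ be the free commutative $k$-algebra generated by isomorphism classes of rooted trees with at least one edge, with unit identified with $\bullet$. A subforest of a rooted tree $t$ is either the trivial subforest $\bullet$ or a nonempty set of pairwise vertex-disjoint subtrees of $t$ each with at least one edge, identified with the product of its components in $\mathcal H$; $t/s$ is the rooted tree obtained by contracting each component of $s$ to a single vertex ($t/\bullet=t$, $t/t=\bullet$). $\mathcal H$ is a Hopf algebra with the multiplicative coproduct $\Delta(t)=\sum_s s\otimes t/s$ over subforests $s$ of $t$ (as subsets of $t$). (2) $\mathcal H_{CK}$ (Connes–Kreimer) is the free commutative $k$-algebra generated by isomorphism classes of nonempty rooted trees (including $\bullet$); monomials are rooted forests, the unit is the empty forest $\mathbf 1$. For a forest $u$ with vertex set $U$, partially ordered by $x\le y$ iff the path from a root to $y$ passes through $x$, $\Delta_{CK}(u)=\sum v\otimes w$, the sum over all ordered decompositions $U=V\sqcup W$ (either part may be empty) such that no vertex of $V$ is strictly below a vertex of $W$, where $v,w$ are the forests induced on $V,W$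 (keeping edges joining two vertices of the same part). (3) $\Phi:\mathcal H_{CK}\to\mathcal H\otimes\mathcal H_{CK}$ is the algebra morphism with $\Phi(\mathbf 1)=\bullet\otimes\mathbf 1$ and, for every nonempty rooted tree $t$, $\Phi(t)=\sum_s s\otimes t/s$ over all subforests $s$ of $t$, with $s\in\mathcal H$ and $t/s$ regarded as a tree in $\mathcal H_{CK}$ (e.g. $\Phi(\bullet)=\bullet\otimes\bullet$). *)

(* Defs.v *)
From HB Require Import structures.
From mathcomp Require Import all_boot all_algebra.
Set Implicit Arguments. Unset Strict Implicit. Unset Printing Implicit Defensive.
Import GRing.Theory.
Local Open Scope ring_scope.

(* A (finite, abstract) rooted forest: a finite vertex type and a parent map
   (None = the vertex is a root).  Its isomorphism class is a monomial of
   H_CK; a forest all of whose trees have >= 1 edge is a monomial of H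
   (the empty forest is the unit of both algebras, i.e. 1 resp. the tree •). *)
Record forest := Forest { fV : finType; fpar : fV -> option fV }.

Definition wf_forest (u : forest) : bool :=
  [forall x : fV u, iter #|fV u| (obind (@fpar u)) (Some x) == None].

Definition anc (u : forest) (x y : fV u) : bool :=
  [exists i : 'I_(#|fV u|.+1), iter i (obind (@fpar u)) (Some y) == Some x].

Definition roots (u : forest) : {set fV u} := [set x | @fpar u x == None].

Definition is_tree (u : forest) : bool := wf_forest u && (#|roots u| == 1)%N.

Definition iso (a b : forest) : bool :=
  [exists f : {ffun fV a -> fV b},
     [&& injectiveb f, #|fV a| == #|fV b| &
         [forall x, @fpar b (f x) == omap f (@fpar a x)]]].

Definition induced (u : forest) (B : {set fV u}) : forest :=
  @Forest {x : fV u | x \in B}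
    (fun x => obind (fun p => insub p) (@fpar u (val x))).

(* empty forest (unit) and disjoint union (product in H and in H_CK) *)
Definition empty_forest : forest := @Forest void (fun x => None).

Definition funion (a b : forest) : forest :=
  @Forest (fV a + fV b)%type
    (fun x => match x with
              | inl y => omap inl (@fpar a y)
              | inr y => omap inr (@fpar b y) end).

Definition fprod (s : seq forest) : forest := foldr funion empty_forest s.

Definition components (u : forest) : seq forest :=
  [seq induced [set x | anc r x] | r <- enum (roots u)].

(* B is the vertex set of a subtree of u with at least one edge:
   it has a top vertex r and is closed under the paths from r *)
Definition subtree_set (u : forest) (B : {set fV u}) : bool :=
  (1 < #|B|)%N &&
  [exists r in B, [forall x in B,
     anc r x && [forall y, (anc r y && anc y x) ==> (y \in B)]]].

(* a subforest: a set of pairwise vertex-disjoint subtrees with >= 1 edge;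
   the empty set of subtrees is the trivial subforest • *)
Definition subforest (u : forest) (P : {set {set fV u}}) : bool :=
  [forall B in P, subtree_set B] &&
  [forall B in P, forall B' in P, (B != B') ==> [disjoint B & B']].

Definition sub_H (u : forest) (P : {set {set fV u}}) : forest :=
  fprod [seq induced B | B <- enum P].

Definition block_top (u : forest) (B : {set fV u}) (y : fV u) : bool :=
  (y \in B) && (if @fpar u y is Some p then p \notin B else true).

Definition crep (u : forest) (P : {set {set fV u}}) (x : fV u) : fV u :=
  if [pick B in P | x \in B] is Some B then odflt x [pick y | block_top B y]
  else x.

Definition contract (u : forest) (P : {set {set fV u}}) : forest :=
  @Forest {x : fV u | crep P x == x}
    (fun x => obind (fun p => insub (crep P p)) (@fpar u (val x))).

Section Vectors.
Variable k : fieldType.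

(* formal k-linear combinations of basis elements *)
Definition vec2 := seq (k * (forest * forest)).
Definition vec3 := seq (k * (forest * forest * forest)).

Definition Phi_tree (t : forest) : vec2 :=
  [seq (1, (sub_H P, contract P)) | P <- enum (@subforest t)].

Definition mul2 (v w : vec2) : vec2 :=
  [seq (a.1 * b.1, (funion a.2.1 b.2.1, funion a.2.2 b.2.2)) | a <- v, b <- w].

Definition one2 : vec2 := [:: (1, (empty_forest, empty_forest))].

(* Phi is the algebra morphism extending Phi_tree *)
Definition Phi (u : forest) : vec2 :=
  foldr mul2 one2 [seq Phi_tree t | t <- components u].

Definition ck_adm (u : forest) (Vs : {set fV u}) : bool :=
  [forall v in Vs, forall w in ~: Vs, ~~ ((v != w) && anc v w)].

Definition DeltaCK (u : forest) : vec2 :=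
  [seq (1, (induced Vs, induced (~: Vs))) | Vs <- enum (@ck_adm u)].

Definition lhs4 (u : forest) : vec3 :=
  flatten [seq [seq (c.1 * d.1, (c.2.1, d.2.1, d.2.2)) | d <- DeltaCK c.2.2]
          | c <- Phi u].

Definition rhs4 (u : forest) : vec3 :=
  flatten [seq [seq (c.1 * a.1 * b.1, (funion a.2.1 b.2.1, a.2.2, b.2.2))
               | a <- Phi c.2.1, b <- Phi c.2.2]
          | c <- DeltaCK u].

Definition iso3 (y x : forest * forest * forest) : bool :=
  [&& iso y.1.1 x.1.1, iso y.1.2 x.1.2 & iso y.2 x.2].

Definition coef3 (v : vec3) (x : forest * forest * forest) : k :=
  \sum_(c <- v | iso3 c.2 x) c.1.

End Vectors.

(* Main.v *)
(** A subforest of [u] amounts to a set of edges of [u], that is, a set [S] of non-root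
vertices, [x] standing for the edge from [x] to its parent: the blocks are the nontrivial
connected components of [S]. With this parametrisation [Phi u] becomes a sum over all edge
sets, which is visibly multiplicative for disjoint unions. An admissible cut of the
contraction of [S] pulls back to an admissible cut of [u] that separates no edge of [S];
conversely an edge set compatible with a cut [(V, ~: V)] is a pair of edge sets, one of the
forest induced on each part. Both sides are therefore the sum over all compatible pairs
(edge set, cut) of the same tensors. *)
Require Import Defs.
From HB Require Import structures.
From mathcomp Require Import all_boot all_algebra.
Set Implicit Arguments. Unset Strict Implicit. Unset Printing Implicit Defensive.
Import GRing.Theory.

(** * Parent maps and presentations of forests *)

(** The form in which well-formedness is used: it gives induction from parent to child, and it
    passes to any forest mapped into [u] with its edges preserved. *)
Definition acyc (u : forest) : Prop :=
  well_founded (fun p x : fV u => fpar x = Some p).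

Lemma wf_acyc u : wf_forest u -> acyc u.
Proof.
move=> /forallP wf x; have /eqP := wf x.
move: {wf}#|_| => n; elim: n x => [//|n IH] x; rewrite iterSr /= => h.
by constructor=> p ep; apply: IH; rewrite -ep.
Qed.

Lemma acyc_morph a b (h : fV a -> fV b) :
    (forall x p, fpar x = Some p -> fpar (h x) = Some (h p)) ->
  acyc b -> acyc a.
Proof.
move=> hP wfb x; have [y ey] : exists y, y = h x by exists (h x).
elim/(well_founded_ind wfb): y x ey => y IH x ey.
by constructor=> p /hP ep; apply: (IH (h p)); rewrite ?ey.
Qed.

Definition prel (T : finType) (q : T -> option T) : rel T := fun x y => q x == Some y.
Definition par_rel (u : forest) : rel (fV u) := prel (@fpar u).
Arguments par_rel : clear implicits.

Lemma connect_prelE (T : finType) (q : T -> option T) x r : connect (prel q) x r =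
  (x == r) || (if q x is Some p then connect (prel q) p r else false).
Proof.
apply/idP/idP=> [/connectP[[|p s] /=]|].
- by move=> _ ->; rewrite eqxx.
- move=> /andP[/eqP -> ps] ->; apply/orP; right; apply/connectP; by exists s.
case/orP=> [/eqP -> //|]; case e: (q x) => [p|//]; apply: connect_trans.
by apply: connect1; rewrite /prel e.
Qed.

Lemma connect_parE u (x r : fV u) : connect (par_rel u) x r =
  (x == r) || (if fpar x is Some p then connect (par_rel u) p r else false).
Proof. exact: connect_prelE. Qed.

Lemma anc_connect u (x y : fV u) : anc x y = connect (par_rel u) y x.
Proof.
apply/existsP/idP => [[[i _] /= /eqP]|].
  elim: i y => [|i IH] y; first by case=> ->.
  rewrite iterSr /= connect_parE; case: fpar => [p /IH ->|]; first by rewrite orbT.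
  by have -> : iter i (obind (@fpar u)) None = None by elim: i {IH} => //= i ->.
(* A path without repetition has fewer steps than there are vertices, so the bound on the iterates
   in [anc] misses no ancestor. *)
case/connectP=> s; case/shortenP=> s' + us _ -> {s}.
have : size s' <= #|fV u|.
  by have := max_card (mem (y :: s')); rewrite (card_uniqP us) => /ltnW.
rewrite -ltnS => hi ps; exists (Ordinal hi) => /=; apply/eqP.
elim: s' y ps {us hi} => [//|p s IH] y /= /andP[/eqP e ps].
by rewrite -iterS iterSr /= e IH.
Qed.

(** A cycle through [x] is also a cycle through its parent [p], which the induction hypothesis at
    [p] excludes. *)
Lemma acyc_noloop u (x p : fV u) :
  acyc u -> fpar x = Some p -> ~~ connect (par_rel u) p x.
Proof.
move=> wf; elim/(well_founded_ind wf): x p => x IH p e.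
apply/negP; rewrite connect_parE => /orP[/eqP ex|].
  by have := IH p e p; rewrite {1}ex e connect0 => /(_ erefl).
case e': fpar => [p'|//] c; have /negP := IH _ e _ e'; apply.
by apply: (connect_trans c); apply: connect1; rewrite /par_rel /prel e.
Qed.

(* All isomorphisms are obtained by embedding both forests in one ambient type with the same
   image [D] and the same parent map [q]. *)
Definition models (T : Type) (D : pred T) (q : T -> option T) (a : forest) :=
  exists h : fV a -> T, [/\ injective h, forall x, D (h x),
    forall y, D y -> exists x, h x = y & forall x, q (h x) = omap h (fpar x)].

Lemma models_eq T (D D' : pred T) q q' a : D =1 D' ->
  (forall x, D x -> q x = q' x) -> models D q a -> models D' q' a.
Proof.
move=> eD eq [h [hi hD hs hq]]; exists h; split=> //.
- by move=> x; rewrite -eD.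
- by move=> y; rewrite -eD; apply: hs.
- by move=> x; rewrite -eq.
Qed.

(** The isomorphism is the first embedding followed by the inverse of the second. *)
Lemma models_iso (T : eqType) (D : pred T) q a b : models D q a -> models D q b -> iso a b.
Proof.
move=> [h1 [i1 d1 s1 q1]] [h2 [i2 d2 s2 q2]].
have /fin_all_exists[f fE] : forall x, exists y, h2 y = h1 x by move=> x; apply: s2.
have /fin_all_exists[g gE] : forall x, exists y, h1 y = h2 x by move=> x; apply: s1.
have fi : injective f by move=> x y e; apply: i1; rewrite -!fE e.
have gi : injective g by move=> x y e; apply: i2; rewrite -!gE e.
apply/existsP; exists [ffun x => f x]; apply/and3P; split.
- by apply/injectiveP => x y; rewrite !ffunE => /fi.
- by rewrite eqn_leq (leq_card f fi) (leq_card g gi).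
apply/forallP => x; rewrite ffunE; apply/eqP; apply: (inj_omap i2).
by rewrite -q2 fE q1; case: fpar => //= y; rewrite ffunE fE.
Qed.

(** Changes the ambient type, for instance from the vertices of an induced forest to those of [u]
    along [val]. *)
Lemma models_inj T T' (j : T -> T') (D : pred T) q (D' : pred T') q' a : injective j ->
    models D q a -> (forall x, D x -> q' (j x) = omap j (q x)) ->
    (forall x, D x -> D' (j x)) -> (forall y, D' y -> exists2 x, D x & j x = y) ->
  models D' q' a.
Proof.
move=> ji [h [hi hD hs hq]] qE D1 D2; exists (j \o h); split.
- exact: inj_comp.
- by move=> x /=; apply: D1.
- by move=> y /D2[x /hs[z <-] <-]; exists z.
- by move=> x /=; rewrite qE // hq; case: fpar.
Qed.

Lemma models_self a : models predT (@fpar a) a.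
Proof. by exists id; split=> // [y|x]; [exists y|case: fpar]. Qed.

Lemma iso_bij a b : iso a b -> exists f : fV a -> fV b, exists g,
  [/\ cancel f g, cancel g f & forall x, fpar (f x) = omap f (fpar x)].
Proof.
case/existsP=> f /and3P[/injectiveP fi /eqP ec /forallP fP].
have [|g fg gf] := inj_card_bij fi; first by rewrite ec.
by exists f, g; split=> // x; apply/eqP.
Qed.

Lemma iso_models a b : iso a b -> models predT (@fpar b) a.
Proof.
case/iso_bij=> f [g [fg gf fP]]; exists f; split=> //; first exact: can_inj fg.
by move=> y _; exists (g y).
Qed.

Lemma models_isol (T : Type) (D : pred T) q a b : iso a b -> models D q b -> models D q a.
Proof.
move=> /iso_models m [h [hi hD hs hq]]; apply: (models_inj hi m) => //.
by move=> y /hs[x <-]; exists x.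
Qed.

Lemma iso_refl a : iso a a.
Proof. exact: models_iso (models_self a) (models_self a). Qed.

Lemma iso_sym a b : iso a b -> iso b a.
Proof. by move=> /iso_models; apply: models_iso; apply: models_self. Qed.

Lemma iso_trans b a c : iso a b -> iso b c -> iso a c.
Proof. by move=> ab /iso_models m; apply: models_iso (models_isol ab m) (models_self c). Qed.

Lemma iso_congr a a' x : iso a a' -> iso a x = iso a' x.
Proof.
by move=> aa'; apply/idP/idP; apply: iso_trans; [apply: iso_sym|].
Qed.

Lemma models_funion T (D1 D2 : pred T) q a b :
    models D1 q a -> models D2 q b -> (forall x, D1 x -> D2 x -> false) ->
  models (predU D1 D2) q (funion a b).
Proof.
move=> [h1 [i1 d1 s1 q1]] [h2 [i2 d2 s2 q2]] dis.
exists (fun z => match z with inl x => h1 x | inr y => h2 y end); split.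
- move=> [x|y] [x'|y'] e; try by rewrite (i1 _ _ e) || rewrite (i2 _ _ e).
    by have := dis (h1 x) (d1 _); rewrite e => /(_ (d2 _)).
  by have := dis (h1 x') (d1 _); rewrite -e => /(_ (d2 _)).
- by case=> [x|y] /=; rewrite ?d1 ?d2 ?orbT.
- by move=> y /= /orP[/s1[x <-]|/s2[x <-]]; [exists (inl x)|exists (inr x)].
- by case=> [x|x]; rewrite ?q1 ?q2 /=; case: fpar.
Qed.

Lemma iso_funion a a' b b' : iso a a' -> iso b b' -> iso (funion a b) (funion a' b').
Proof.
move=> /iso_models ma /iso_models mb.
pose D1 (z : fV (funion a' b')) := if z is inl _ then true else false.
pose D2 (z : fV (funion a' b')) := ~~ D1 z.
have m1 : models D1 (@fpar (funion a' b')) a.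
  by apply: (models_inj (@inl_inj _ _) ma) => // -[x|//] _; exists x.
have m2 : models D2 (@fpar (funion a' b')) b.
  by apply: (models_inj (@inr_inj _ _) mb) => // -[//|x] _; exists x.
apply: models_iso (models_self _).
by apply: models_eq (models_funion m1 m2 _) => // -[].
Qed.

(** * Induced forests and connected components *)

Definition mk_forest (T : finType) (D : pred T) (q : T -> option T) : forest :=
  @Forest {x : T | D x} (fun x => obind insub (q (val x))).

(** Stays on the ambient type rather than on a subtype, so that forests built on different subtypes
    can be given one common parent map. *)
Definition restr T (D : pred T) (q : T -> option T) x :=
  obind (fun p => if D p then Some p else None) (q x).

Lemma models_sub (T : finType) (D : pred T) q (f : {x : T | D x} -> option {x : T | D x}) :
  (forall x, f x = obind insub (q (val x))) -> models D (restr D q) (Forest f).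
Proof.
move=> fE; exists val; split=> [|x|y Dy|x]; first exact: val_inj.
- exact: valP.
- by exists (exist _ y Dy).
- rewrite /restr /= fE; case: (q _) => [p|//] /=.
  by case: insubP => [z -> <-|/negbTE ->].
Qed.

Lemma models_mk (T : finType) (D : pred T) q : models D (restr D q) (mk_forest D q).
Proof. exact: models_sub. Qed.

Lemma models_induced u (B : {set fV u}) :
  models (fun x => x \in B) (restr (fun x => x \in B) (@fpar u)) (induced B).
Proof. exact: models_mk. Qed.

Lemma par_inducedE u (B : {set fV u}) (x : fV (induced B)) :
  restr (fun x => x \in B) (@fpar u) (val x) = omap val (fpar x).
Proof.
have -> : fpar x = obind insub (fpar (val x)) by [].
rewrite /restr; case: (fpar (val x)) => [z|//] /=.
by case: insubP => [w -> <-|/negbTE ->].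
Qed.

Lemma par_induced u (B : {set fV u}) (x p : fV (induced B)) :
  fpar x = Some p -> fpar (val x) = Some (val p).
Proof.
have := par_inducedE x; rewrite /restr; case: (fpar (val x)) => [z|] /= + e; rewrite e //=.
by case: ifP.
Qed.

Lemma acyc_induced u (B : {set fV u}) : acyc u -> acyc (induced B).
Proof. exact: (acyc_morph (@par_induced u B)). Qed.

Lemma acyc_iso a b : iso a b -> acyc b -> acyc a.
Proof.
case/iso_bij=> f [g [_ _ fP]]; apply: (acyc_morph (h := f)) => x p e.
by rewrite fP e.
Qed.

(** Serves both products of induced forests: the components of [u], indexed by its roots, and the
    blocks of a subforest in [sub_H]. *)
Lemma models_fprod u (I : eqType) (L : seq I) (B : I -> {set fV u}) q : uniq L ->
    (forall i j x, i \in L -> j \in L -> x \in B i -> x \in B j -> i = j) ->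
    (forall i x, i \in L -> x \in B i ->
       restr (fun x => x \in B i) (@fpar u) x = q x) ->
  models (fun x => has (fun i => x \in B i) L) q (Defs.fprod [seq induced (B i) | i <- L]).
Proof.
elim: L => [_ _ _|i L IH /= /andP[iL uL] dis qE].
  by exists (fun z : void => match z with end); split=> [[]|[]|//|[]].
have m1 : models (fun x => x \in B i) q (induced (B i)).
  by apply: models_eq (models_induced _) => // x; apply: qE; rewrite mem_head.
have m2 := IH uL _ _; apply: models_eq (models_funion m1 (m2 _ _) _) => //.
- by move=> i' j x hi hj; apply: dis; rewrite inE ?hi ?hj orbT.
- by move=> i' x hi; apply: qE; rewrite inE hi orbT.
move=> x xi /hasP[j jL xj]; have ij : i = j.
  by apply: (dis i j x); rewrite ?inE ?eqxx ?jL ?orbT.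
by rewrite ij jL in iL.
Qed.

(** Following parents from a vertex ends at exactly one root, and a vertex has the same root as its
    parent; so the components partition [u] and cut no edge. *)
Lemma iso_components u : acyc u -> iso (Defs.fprod (components u)) u.
Proof.
move=> wf; apply: models_iso (models_self u).
apply: models_eq (models_fprod (q := @fpar u) (enum_uniq _) _ _) => // [x|r r' x|r x].
- apply/hasP; elim/(well_founded_ind wf): x => x IH.
  case e: (fpar x) => [p|]; last first.
    by exists x; rewrite ?mem_enum inE ?e // anc_connect.
  have [r rr] := IH _ e; rewrite !inE anc_connect => c; exists r => //.
  by rewrite inE anc_connect connect_parE e c orbT.
- rewrite !mem_enum !inE !anc_connect => /eqP er /eqP er'.
  elim/(well_founded_ind wf): x => x IH; rewrite !(connect_parE x).
  case: eqP => [->|_]; first by rewrite er !orbF => _ /eqP.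
  case: (x =P r') => [->|_]; first by rewrite er' => /=.
  by case e: fpar => [p|//] /=; apply: IH.
rewrite mem_enum !inE anc_connect => /eqP er; rewrite connect_parE /restr.
case: eqP => [->|_]; first by rewrite er.
by case e: fpar => [p|//] /=; rewrite inE anc_connect => ->.
Qed.

(** * Edge sets *)

(* [x \in S] stands for the edge from [x] to its parent. *)
Definition edge_set u (S : {set fV u}) : bool := [forall x in S, fpar x != None].

Definition kept u (S : {set fV u}) (x : fV u) := if x \in S then fpar x else None.

(* The root of the [S]-component of [x]; the default [x] is never used when [u] is acyclic
   and [S] contains no root. *)
Definition top u (S : {set fV u}) (x : fV u) : fV u :=
  odflt x [pick y | connect (prel (kept S)) x y && (y \notin S)].

(** The ends of the edges in [S]. Every other vertex would be a component without edges, hence the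
    unit of $\mathcal H$, and must not show up in the forest. *)
Definition supp u (S : {set fV u}) (x : fV u) : bool :=
  (x \in S) || [exists y in S, fpar y == Some x].

Definition edge_forest u (S : {set fV u}) : forest := mk_forest (supp S) (kept S).

(** When [u] is acyclic and [S] contains no root, each component has exactly one vertex outside [S],
    its root, which represents it here. *)
Definition contract_edges u (S : {set fV u}) : forest :=
  mk_forest (fun x => x \notin S) (fun x => omap (top S) (fpar x)).

Lemma edge_setP u (S : {set fV u}) :
  reflect (forall x, x \in S -> exists p, fpar x = Some p) (edge_set S).
Proof.
apply: (iffP forall_inP) => h x /h; first by case: fpar => [p|//]; exists p.
by case=> p ->.
Qed.

Lemma top_out u (S : {set fV u}) x : x \notin S -> top S x = x.
Proof.
move=> xS; rewrite /top; case: pickP => [y /= /andP[]|//].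
by rewrite connect_prelE /kept (negbTE xS) orbF => /eqP.
Qed.

Lemma top_in u (S : {set fV u}) x p : acyc u -> edge_set S ->
  x \in S -> fpar x = Some p -> top S x = top S p.
Proof.
move=> wf /edge_setP eS xS e.
(* A candidate exists, so neither [pick] falls back on its default, which would be [x] on one side
   and [p] on the other. *)
have [y yP] : exists y, connect (prel (kept S)) p y && (y \notin S).
  elim/(well_founded_ind wf): p {x xS e} => p IH.
  have [pS|pS] := boolP (p \in S); last by exists p; rewrite connect0.
  have [p' e] := eS _ pS; have [y /andP[c yS]] := IH _ e; exists y.
  by rewrite yS connect_prelE /kept pS e c orbT.
(* As [x] lies in [S] it is not a candidate itself; [x] and [p] thus have the same candidates and
   the same pick. *)
rewrite /top (eq_pick (Q := fun y => connect (prel (kept S)) p y && (y \notin S))).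
  by case: pickP => // /(_ y); rewrite yP.
move=> z /=; rewrite (connect_prelE _ x) /kept xS e.
by case: eqP => [<-|//]; rewrite xS !andbF.
Qed.

Lemma top_notin u (S : {set fV u}) x : acyc u -> edge_set S -> top S x \notin S.
Proof.
move=> wf eS; elim/(well_founded_ind wf): x => x IH.
have [xS|xS] := boolP (x \in S); last by rewrite top_out.
by have [p e] := edge_setP _ eS _ xS; rewrite (top_in wf eS xS e) IH.
Qed.

Lemma models_edge_forest u (S : {set fV u}) : models (supp S) (kept S) (edge_forest S).
Proof.
apply: models_eq (models_mk _ _) => // x _; rewrite /restr /kept.
case: ifP => // xS; case e: fpar => [p|] //=.
suff -> : supp S p by [].
by apply/orP; right; apply/existsP; exists x; rewrite xS e eqxx.
Qed.

Lemma models_contract_edges u (S : {set fV u}) : acyc u -> edge_set S ->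
  models (fun x => x \notin S) (fun x => omap (top S) (fpar x)) (contract_edges S).
Proof.
move=> wf eS; apply: models_eq (models_mk _ _) => // x _; rewrite /restr.
by case: fpar => [p|//] /=; rewrite top_notin.
Qed.

(** Parents are compared on [Sa] only, so that the inclusion of an induced forest, which may lose
    other edges, is covered along with isomorphisms. *)
Lemma top_morph a b (j : fV a -> fV b) Sa Sb x : acyc a -> acyc b ->
    edge_set Sa -> edge_set Sb -> (forall x, (j x \in Sb) = (x \in Sa)) ->
    (forall x, x \in Sa -> fpar (j x) = omap j (fpar x)) ->
  top Sb (j x) = j (top Sa x).
Proof.
move=> wa wb ea eb jS jp; elim/(well_founded_ind wa): x => x IH.
have [xS|xS] := boolP (x \in Sa); last by rewrite !top_out ?jS.
have [p e] := edge_setP _ ea _ xS; rewrite (top_in wa ea xS e) -IH //.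
by apply: top_in; rewrite ?jS // jp // e.
Qed.

(** * Edge sets compatible with a cut *)

Definition compat u (V S : {set fV u}) : bool :=
  [forall x in S, forall p, (fpar x == Some p) ==> ((x \in V) == (p \in V))].

Lemma compatP u (V S : {set fV u}) :
  reflect (forall x p, x \in S -> fpar x = Some p -> (x \in V) = (p \in V))
          (compat V S).
Proof.
apply: (iffP forall_inP) => h x.
  by move=> p xS e; have /forallP/(_ p) := h x xS; rewrite e eqxx => /eqP.
by move=> xS; apply/forallP => p; apply/implyP => /eqP e; apply/eqP; apply: h.
Qed.

Lemma compatC u (V S : {set fV u}) : compat (~: V) S = compat V S.
Proof.
apply/compatP/compatP => h x p xS e; have := h x p xS e; rewrite !inE; last by move->.
exact: negb_inj.
Qed.

Lemma compat_top u (V S : {set fV u}) x : acyc u -> edge_set S -> compat V S ->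
  (top S x \in V) = (x \in V).
Proof.
move=> wf eS /compatP cS; elim/(well_founded_ind wf): x => x IH.
have [xS|xS] := boolP (x \in S); last by rewrite !top_out.
have [p e] := edge_setP _ eS _ xS.
by rewrite (top_in wf eS xS e) IH // (cS x p).
Qed.

(** The part in [V] of the contraction of [S], written on the vertices of [u]. Contracting then
    cutting and cutting then contracting are both compared with it. *)
Definition cutcon u (V S : {set fV u}) : forest :=
  mk_forest (fun x => (x \in V) && (x \notin S))
    (fun x => omap (top S) (restr (fun y => y \in V) (@fpar u) x)).

Definition trace u (V S : {set fV u}) : {set fV (induced V)} := [set z | val z \in S].

Lemma models_cutcon u (V S : {set fV u}) : acyc u -> edge_set S -> compat V S ->
  models (fun x => (x \in V) && (x \notin S))
    (fun x => omap (top S) (restr (fun y => y \in V) (@fpar u) x)) (cutcon V S).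
Proof.
move=> wf eS cS; apply: models_eq (models_mk _ _) => // x _; rewrite /restr.
case: fpar => [p|//] /=; case: ifP => //= pV.
by rewrite compat_top // pV top_notin.
Qed.

(** A vertex of [S] whose parent lies across the cut becomes a root of its part, so its trace is no
    longer an edge set; this is how pairs of edge sets encode compatibility. *)
Lemma edge_set_traces u (V S : {set fV u}) :
  edge_set (trace V S) && edge_set (trace (~: V) S) = edge_set S && compat V S.
Proof.
have tr (W : {set fV u}) : reflect (forall x, x \in S -> x \in W ->
      exists2 p, fpar x = Some p & p \in W) (edge_set (trace W S)).
  apply: (iffP (edge_setP _)) => [h x xS xW|h z].
    have [|p e] := h (exist _ x xW); first by rewrite inE.
    by exists (val p); [apply: (par_induced e)|apply: (valP p)].
  rewrite inE => zS; have [p e pW] := h _ zS (valP z).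
  have := par_inducedE z; case: (fpar z) => [p' _|]; first by exists p'.
  by rewrite /restr e /= pW.
apply/andP/andP => [[/tr h1 /tr h2]|[/edge_setP eS /compatP cS]].
  split; [apply/edge_setP => x xS|apply/compatP => x p xS e].
    by case xV: (x \in V); [have [//|p] := h1 x xS|have [|p] := h2 x xS];
      rewrite ?inE ?xV //; exists p.
  case xV: (x \in V).
    by have [//|p'] := h1 x xS; rewrite e => -[->] ->.
  have [|p'] := h2 x xS; first by rewrite inE xV.
  by rewrite e => -[->]; rewrite inE => /negbTE ->.
split; apply/tr => x xS xV; have [p e] := eS _ xS; exists p => //.
  by rewrite -(cS x p).
by move: xV; rewrite !inE (cS x p).
Qed.

Lemma models_edge_forest_trace u (V S : {set fV u}) : compat V S ->
  models (fun x => (x \in V) && supp S x) (kept S) (edge_forest (trace V S)).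
Proof.
move=> /compatP cS.
apply: (models_inj (j := val : fV (induced V) -> fV u) val_inj (models_edge_forest _)) => [z _|z|y].
- rewrite -[RHS]/(omap val _) /kept inE; case: ifP => // zS; rewrite -par_inducedE /restr.
  case e: fpar => [p|//] /=.
  by rewrite -(cS _ _ zS e) (valP z).
- rewrite (valP z) /= => /orP[|/existsP[y /andP[+ /eqP e]]].
    by rewrite inE /supp => ->.
  rewrite inE => yS; apply/orP; right; apply/existsP; exists (val y).
  by rewrite yS (par_induced e) eqxx.
move=> /andP[yV yP]; exists (exist _ y yV) => //; case/orP: yP => [yS|].
  by rewrite /supp inE yS.
case/existsP=> x /andP[xS /eqP e]; have xV : x \in V by rewrite (cS _ _ xS e).
pose z : fV (induced V) := exist _ x xV.
apply/orP; right; apply/existsP; exists z; rewrite inE xS andTb.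
have := par_inducedE z; case: (fpar z) => [w|]; rewrite /restr /= e /= yV // => -[yw].
by apply/eqP; congr Some; apply: val_inj.
Qed.

(** Compatibility places each component of [S] wholly on one side. This is the product $ac$ formed
    by $m^{1,3}$. *)
Lemma iso_edge_forest_traces u (V S : {set fV u}) : compat V S ->
  iso (funion (edge_forest (trace V S)) (edge_forest (trace (~: V) S))) (edge_forest S).
Proof.
move=> cS; apply: models_iso (models_edge_forest S).
have c' : compat (~: V) S by rewrite compatC.
apply: models_eq (models_funion (models_edge_forest_trace cS) (models_edge_forest_trace c') _) => //.
  by move=> x /=; rewrite inE; case: (x \in V); rewrite ?orbF.
by move=> x; rewrite inE; case: (x \in V).
Qed.

Lemma iso_con_trace u (V S : {set fV u}) : acyc u -> edge_set S -> compat V S ->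
  iso (contract_edges (trace V S)) (cutcon V S).
Proof.
move=> wf eS cS.
have /andP[et _] : edge_set (trace V S) && edge_set (trace (~: V) S).
  by rewrite edge_set_traces eS.
apply: models_iso (models_cutcon wf eS cS).
have wV := acyc_induced (B := V) wf.
apply: (models_inj (j := val : fV (induced V) -> fV u) val_inj (models_contract_edges wV et)) => [z _|z|y].
- rewrite par_inducedE; case: fpar => [p|//] /=; congr Some.
  apply: (top_morph (a := induced V) (j := val)) => // [x|x]; rewrite inE // => xS.
  rewrite -par_inducedE /restr; have /compatP cS' := cS.
  by case e: fpar => [r|//] /=; rewrite -(cS' _ _ xS e) (valP x).
- by rewrite inE (valP z).
by move=> /andP[yV yS]; exists (exist _ y yV); rewrite ?inE.
Qed.

(** * Subforests as edge sets *)

Definition edges_of u (P : {set {set fV u}}) : {set fV u} :=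
  [set x | [exists B in P, (x \in B) && (if fpar x is Some p then p \in B else false)]].

(** Indexing by [x] in [S] leaves out the one-vertex components. *)
Definition blocks_of u (S : {set fV u}) : {set {set fV u}} :=
  [set [set y | top S y == top S x] | x in S].

Lemma edges_ofP u (P : {set {set fV u}}) x :
  reflect (exists B p, [/\ B \in P, x \in B, fpar x = Some p & p \in B]) (x \in edges_of P).
Proof.
rewrite inE; apply: (iffP exists_inP) => [[B BP /andP[xB]]|[B [p [BP xB e pB]]]].
  by case: fpar => [p|//] pB; exists B, p.
by exists B; rewrite // xB e.
Qed.

Lemma edge_set_edges_of u (P : {set {set fV u}}) : edge_set (edges_of P).
Proof. by apply/edge_setP => x /edges_ofP[B [p [_ _ e _]]]; exists p. Qed.

Lemma connect_top u (S : {set fV u}) x : acyc u -> edge_set S ->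
  connect (par_rel u) x (top S x).
Proof.
move=> wf eS; elim/(well_founded_ind wf): x => x IH.
have [xS|xS] := boolP (x \in S); last by rewrite top_out.
have [p e] := edge_setP _ eS _ xS.
by rewrite (top_in wf eS xS e) connect_parE e IH ?orbT.
Qed.

Lemma subforest_blocks u (S : {set fV u}) :
  acyc u -> edge_set S -> subforest (blocks_of S).
Proof.
move=> wf eS; apply/andP; split; last first.
  apply/forall_inP => _ /imsetP[x _ ->]; apply/forall_inP => _ /imsetP[y _ ->].
  apply/implyP; apply: contraR => /pred0Pn[z /=]; rewrite !inE.
  by move=> /andP[/eqP <- /eqP <-].
apply/forall_inP => _ /imsetP[x xS ->]; apply/andP; split.
  have [p e] := edge_setP _ eS _ xS; apply/card_gt1P; exists x, p.
  rewrite !inE (top_in wf eS xS e); split=> //.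
  by apply: contraL (acyc_noloop wf e) => /eqP ->; rewrite connect0.
apply/existsP; exists (top S x); rewrite inE (top_out (top_notin x wf eS)) eqxx /=.
apply/forall_inP => y; rewrite inE => /eqP ty.
rewrite anc_connect -{1}ty connect_top //=; apply/forallP => z; apply/implyP.
rewrite !anc_connect inE => /andP[zx yz]; apply/eqP.
(* The path from [y] towards [z] could leave the block only at a vertex outside [S], that is at
   [top S x]; but [z] leads back to [top S x], which would close a cycle. *)
elim/(well_founded_ind wf): y ty yz => y IH ty.
rewrite connect_parE => /orP[/eqP <-//|]; case e: fpar => [p|//] pz.
have [yS|yS] := boolP (y \in S); first by apply: (IH p) => //; rewrite -(top_in wf eS yS e).
have /negP[] := acyc_noloop wf e; apply: (connect_trans pz).
by rewrite -(top_out yS) ty.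
Qed.

(** A vertex outside [S] is the root of its component; a parent in the same component would lead
    back to it. *)
Lemma edges_of_blocks u (S : {set fV u}) :
  acyc u -> edge_set S -> edges_of (blocks_of S) = S.
Proof.
move=> wf eS; apply/setP => x; apply/edges_ofP/idP => [[B [p [/imsetP[y yS ->]]]]|xS].
  rewrite !inE => /eqP tx e /eqP tp; apply: contraTT (acyc_noloop wf e) => xS.
  by rewrite negbK -(top_out xS) tx -tp connect_top.
have [p e] := edge_setP _ eS _ xS.
exists [set y | top S y == top S x], p; rewrite !inE (top_in wf eS xS e); split=> //.
by apply/imsetP; exists x; rewrite ?(top_in wf eS xS e).
Qed.

Section Subforest.
Variables (u : forest) (P : {set {set fV u}}).
Hypotheses (wf : acyc u) (sP : subforest P).
Let E := edges_of P.
Let eE : edge_set E := edge_set_edges_of P.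

Lemma subforest_inj B B' x : B \in P -> B' \in P -> x \in B -> x \in B' -> B = B'.
Proof.
move=> BP BP' xB xB'; apply/eqP; case/andP: sP => _ /forall_inP/(_ _ BP)/forall_inP/(_ _ BP').
by apply: contraTT => ->; apply/pred0Pn; exists x; rewrite /= xB.
Qed.

(** Closure under paths puts the parent of every vertex other than [r] in the block; acyclicity
    keeps the parent of [r] out. *)
Lemma subforest_root B : B \in P -> exists r, [/\ r \in B,
  forall x, x \in B -> x != r -> x \in E &
  forall p, fpar r = Some p -> p \notin B].
Proof.
move=> BP; case/andP: sP => /forall_inP/(_ _ BP)/andP[_ /existsP[r /andP[rB /forall_inP h]]] _.
exists r; split=> // [x xB xr|p e].
  have := h x xB; rewrite anc_connect connect_parE (negbTE xr) /=.
  case e: fpar => [p|//] /andP[pr /forallP/(_ p)/implyP cl].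
  apply/edges_ofP; exists B, p; split=> //; apply: cl.
  by rewrite !anc_connect pr connect_parE e connect0 orbT.
apply: contraL (acyc_noloop wf e) => /h /andP[+ _].
by rewrite anc_connect => ->.
Qed.

(** By disjointness of the blocks, an edge of [E] has both ends in [B] or neither, and [r] is the
    only vertex of [B] that can lie outside [E]. *)
Lemma top_edges_of B r x : B \in P -> r \in B ->
    (forall x, x \in B -> x != r -> x \in E) ->
    (forall p, fpar r = Some p -> p \notin B) ->
  (top E x == r) = (x \in B).
Proof.
move=> BP rB hB hr; elim/(well_founded_ind wf): x => x IH.
have [xE|xE] := boolP (x \in E); last first.
  rewrite top_out //; apply/eqP/idP => [->//|xB]; apply/eqP.
  by apply: contraR xE; apply: hB.
have [p e] := edge_setP _ eE _ xE; rewrite (top_in wf eE xE e) (IH _ e).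
have [B' [p' [BP' xB']]] := edges_ofP _ _ xE; rewrite e => -[<-] pB'.
by apply/idP/idP => h; rewrite (@subforest_inj B B' _ BP BP' h).
Qed.

Lemma blocks_of_edges : blocks_of E = P.
Proof.
apply/setP => B; apply/imsetP/idP => [[x xE ->]|BP].
  have [B' [p [BP' xB' _ _]]] := edges_ofP _ _ xE.
  have [r [rB hB hr]] := subforest_root BP'.
  suff -> : [set y | top E y == top E x] = B' by [].
  apply/setP => y; rewrite inE.
  have /eqP -> : top E x == r by rewrite (top_edges_of x BP' rB).
  exact: top_edges_of.
have [r [rB hB hr]] := subforest_root BP.
case/andP: sP => /forall_inP/(_ _ BP)/andP[/card_gt1P[x [y [xB yB xy]]] _] _.
(* Of two distinct vertices of [B] one is not the root, hence lies in [E] and can index [B] in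
   [blocks_of E]. *)
have [z zB zr] : exists2 z, z \in B & z != r.
  by have [xr|] := eqVneq x r; [exists y; rewrite // -xr eq_sym|exists x].
exists z; first exact: hB.
have /eqP -> : top E z == r by rewrite (top_edges_of z BP rB).
by apply/setP => w; rewrite inE (top_edges_of w BP rB).
Qed.

Lemma crepE x : crep P x = top E x.
Proof.
rewrite /crep; case: pickP => [B /andP[BP xB]|h]; last first.
  rewrite top_out //; apply/negP => /edges_ofP[B [p [BP xB _ _]]].
  by have := h B; rewrite BP xB.
have [r [rB hB hr]] := subforest_root BP.
have /eqP -> : top E x == r by rewrite (top_edges_of x BP rB).
(* This rules out the default of [odflt]; the pick is then [r], since any other vertex of [B] has
   its parent in [B]. *)
have rtop : block_top B r.
  by rewrite /block_top rB; case e: fpar => [p|//]; apply: hr.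
case: pickP => [y|/(_ r)]; last by rewrite rtop.
move=> /andP[yB yp] /=; apply/eqP; apply: contraLR yp => yr.
have [B' [p [BP' yB' e pB']]] := edges_ofP _ _ (hB _ yB yr).
by rewrite e negbK (subforest_inj BP BP' yB yB').
Qed.

Lemma iso_sub_H : iso (sub_H P) (edge_forest E).
Proof.
apply: models_iso (models_edge_forest E).
have m := @models_fprod u _ (enum P) id (kept E) (enum_uniq _) _ _.
apply: models_eq (m _ _) => // [x|B B' x|B x]; rewrite ?mem_enum; last first.
- move=> BP xB; rewrite /restr /kept; case: ifP => [xE|/negP xE].
    have [B' [p [BP' xB']]] := edges_ofP _ _ xE.
    by move=> -> pB'; rewrite /= (subforest_inj BP BP' xB xB') pB'.
  case e: fpar => [p|//] /=; case: ifP => // pB; case: xE.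
  by apply/edges_ofP; exists B, p.
- exact: subforest_inj.
apply/hasP/orP => [[B]|[/edges_ofP[B [p [BP xB _ _]]]|/existsP[y /andP[+ /eqP e]]]].
- rewrite mem_enum => BP xB; have [r [rB hB hr]] := subforest_root BP.
  have [xr|] := eqVneq x r; last by left; apply: hB.
  (* The root of a block is in the support as the parent of some vertex of [E]: start from any [y]
     of [E] in [B] and follow parents until the next one is [r]. *)
  right; move: (BP); rewrite -{1}blocks_of_edges => /imsetP[y yE BE].
  have yB : y \in B by rewrite BE inE.
  elim/(well_founded_ind wf): y yE yB {BE} => y IH yE yB.
  have [B' [p [BP' yB' e]]] := edges_ofP _ _ yE.
  rewrite -(subforest_inj BP BP' yB yB') => pB; have [pr|pr] := eqVneq p r.
    by apply/existsP; exists y; rewrite yE e xr pr eqxx.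
  exact: (IH p e (hB _ pB pr) pB).
- by exists B; rewrite ?mem_enum.
case/edges_ofP=> B [p [BP yB]]; rewrite e => -[<-] xB; exists B => //.
by rewrite mem_enum.
Qed.

Lemma iso_contract : iso (contract P) (contract_edges E).
Proof.
apply: models_iso (models_contract_edges wf eE).
apply: (models_eq _ _ (models_sub (q := fun x => omap (crep P) (fpar x)) _)) => [x|x _|x].
- rewrite crepE; apply/eqP/idP => [<-|]; [exact: top_notin|exact: top_out].
- by rewrite /restr; case: fpar => [p|//] /=; rewrite !crepE (top_out (top_notin _ wf eE)) eqxx.
by case: fpar.
Qed.
End Subforest.

(** * Sums over edge sets and cuts *)

Section Sums.
Variable k : fieldType.
Local Open Scope ring_scope.

(** Functions of isomorphism classes, to be extended linearly to tensors. A coefficient is the value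
    of one of them, the indicator of a class. *)
Definition iso_invariant2 (F : forest -> forest -> k) : Prop :=
  forall a a' b b', iso a a' -> iso b b' -> F a b = F a' b'.

Definition iso_invariant3 (F : forest -> forest -> forest -> k) : Prop :=
  forall a a' b b' c c', iso a a' -> iso b b' -> iso c c' -> F a b c = F a' b' c'.

Definition Phi_sum u (F : forest -> forest -> k) : k :=
  \sum_(S : {set fV u} | edge_set S) F (edge_forest S) (contract_edges S).

Lemma eq_Phi_sum u F G : (forall a b, F a b = G a b) -> Phi_sum u F = Phi_sum u G.
Proof. by move=> FG; apply: eq_bigr. Qed.

Lemma Phi_sum_subforest u F : acyc u -> iso_invariant2 F ->
  \sum_(P | @subforest u P) F (sub_H P) (contract P) = Phi_sum u F.
Proof.
move=> wf Fi; rewrite (reindex_onto (@blocks_of u) (@edges_of u)) => [|P]; last exact: blocks_of_edges.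
apply: eq_big => [S|S /andP[sS /eqP eS]].
  apply/andP/idP => [[_ /eqP <-]|eS]; first exact: edge_set_edges_of.
  by rewrite subforest_blocks ?edges_of_blocks.
have i1 := iso_sub_H wf sS; have i2 := iso_contract wf sS.
by rewrite -{3 4}eS; apply: Fi.
Qed.

Lemma Phi_sum_iso a b F : iso_invariant2 F -> acyc b -> iso a b -> Phi_sum a F = Phi_sum b F.
Proof.
move=> Fi wb ab; have wa := acyc_iso ab wb; have [f [g [fg gf fP]]] := iso_bij ab.
pose h (S : {set fV a}) := g @^-1: S.
have hb : bijective h.
  by exists (fun S : {set fV b} => f @^-1: S) => S; apply/setP => x; rewrite !inE ?fg ?gf.
have hS S x : (f x \in h S) = (x \in S) by rewrite inE fg.
rewrite /Phi_sum [RHS](reindex h); last exact: onW_bij.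
have eE S : edge_set (h S) = edge_set S.
  apply/edge_setP/edge_setP => eS x.
    by rewrite -hS => /eS[p]; rewrite fP; case: fpar => [q|//] _; exists q.
  by rewrite -(gf x) hS => /eS[p e]; exists (f p); rewrite fP e.
apply: eq_big => [S|S eS]; first by rewrite eE.
have fi := can_inj fg; apply: Fi.
  apply: models_iso (models_edge_forest _); apply: (models_inj fi (models_edge_forest _)) => [x _|x|y].
  - by rewrite /kept hS fP; case: ifP.
  - case/orP=> [xS|/existsP[y /andP[yS /eqP e]]]; apply/orP; [left|right]; first by rewrite hS.
    by apply/existsP; exists (f y); rewrite hS yS fP e eqxx.
  case/orP=> [yS|/existsP[x /andP[xS /eqP e]]]; exists (g y); rewrite ?gf //; apply/orP.
    by left; rewrite -hS gf.
  right; apply/existsP; exists (g x); rewrite -hS gf xS; apply/eqP/(inj_omap fi).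
  by rewrite -fP /= !gf.
have eS' : edge_set (h S) by rewrite eE.
apply: models_iso (models_contract_edges wb eS').
apply: (models_inj fi (models_contract_edges wa eS)) => [x _|x|y].
- rewrite fP; case: fpar => [p|//] /=; congr Some; exact: top_morph.
- by rewrite hS.
by move=> yS; exists (g y); rewrite ?gf // -hS gf.
Qed.

(** Taking traces on the two parts is inverse to taking the union of two edge sets. With a fixed cut
    this computes $m^{1,3}\circ(\Phi\otimes\Phi)$. *)
Lemma Phi_sum_induced u (V : {set fV u}) F : acyc u -> iso_invariant3 F ->
  Phi_sum (induced V) (fun a1 a2 =>
    Phi_sum (induced (~: V)) (fun b1 b2 => F (funion a1 b1) a2 b2)) =
  \sum_(S : {set fV u} | edge_set S && compat V S)
     F (edge_forest S) (cutcon V S) (cutcon (~: V) S).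
Proof.
move=> wf Fi; rewrite /Phi_sum pair_big /=.
rewrite (reindex (fun S : {set fV u} => (trace V S, trace (~: V) S))) /=; last first.
  exists (fun p : {set fV (induced V)} * {set fV (induced (~: V))} =>
      [set val x | x in p.1] :|: [set val x | x in p.2]) => [S _ /=|[S1 S2] _ /=].
    apply/setP => x; rewrite inE; apply/orP/idP.
      by case=> /imsetP[z + ->]; rewrite inE.
    move=> xS; case xV : (x \in V); [left|right].
      by apply/imsetP; exists (exist _ x xV); rewrite ?inE.
    have xV' : x \in ~: V by rewrite inE xV.
    by apply/imsetP; exists (exist _ x xV'); rewrite ?inE.
  congr pair; apply/setP => z; rewrite !inE.
    rewrite mem_imset; last exact: val_inj.
    case: imsetP => [[w _ e]|_]; last by rewrite orbF.
    have zw : val z = val w := e; have : val w \in ~: V := valP w.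
    by rewrite -zw inE (valP z).
  rewrite orbC mem_imset; last exact: val_inj.
  case: imsetP => [[w _ e]|_]; last by rewrite orbF.
  have zw : val z = val w := e; have : val z \in ~: V := valP z.
  by rewrite zw inE (valP w).
apply: eq_big => [S|S]; first exact: edge_set_traces.
rewrite edge_set_traces => /andP[eS cS]; apply: Fi.
- exact: iso_edge_forest_traces.
- exact: iso_con_trace.
by apply: iso_con_trace; rewrite ?compatC.
Qed.

(** The two summands form a cut crossed by no edge, so every edge set is compatible with it and
    [Phi_sum_induced] applies; [G] multiplies the two contractions together again. *)
Lemma Phi_sum_funion a b F : acyc (funion a b) -> iso_invariant2 F ->
  Phi_sum (funion a b) F =
  Phi_sum a (fun a1 a2 => Phi_sum b (fun b1 b2 => F (funion a1 b1) (funion a2 b2))).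
Proof.
move=> wf Fi.
have wa : acyc a by apply: (acyc_morph (h := inl : _ -> fV (funion a b)) _ wf) => x p /= ->.
have wb : acyc b by apply: (acyc_morph (h := inr : _ -> fV (funion a b)) _ wf) => x p /= ->.
pose V : {set fV (funion a b)} := [set z | if z is inl _ then true else false].
have parV x p : @fpar (funion a b) x = Some p -> (x \in V) = (p \in V).
  by rewrite !inE; case: x => x /=; case: fpar => //= y [<-].
have ia : iso (induced V) a.
  apply: models_iso (models_induced V) _.
  apply: (models_inj (@inl_inj _ _) (models_self a)) => [x _|x _|]; rewrite ?inE //.
    by rewrite /restr /=; case: fpar => //= p; rewrite inE.
  by case=> [x _|x]; [exists x|rewrite inE].
have ib : iso (induced (~: V)) b.
  apply: models_iso (models_induced (~: V)) _.
  apply: (models_inj (@inr_inj _ _) (models_self b)) => [x _|x _|]; rewrite ?inE //.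
    by rewrite /restr /=; case: fpar => //= p; rewrite !inE.
  by case=> [x|x _]; [rewrite !inE|exists x].
pose G a1 a2 b2 := F a1 (funion a2 b2).
have Gi : iso_invariant3 G.
  by move=> x x' y y' z z' ix iy iz; apply: Fi => //; apply: iso_funion.
transitivity (\sum_(S : {set fV (funion a b)} | edge_set S && compat V S)
     G (edge_forest S) (cutcon V S) (cutcon (~: V) S)).
  apply: eq_big => [S|S eS].
    by rewrite andbC (_ : compat V S) //; apply/compatP => x p _; apply: parV.
  have cS : compat V S by apply/compatP => x p _; apply: parV.
  have cS' : compat (~: V) S by rewrite compatC.
  apply: Fi; first exact: iso_refl.
  apply: models_iso (models_contract_edges wf eS) _.
  have m1 := models_cutcon wf eS cS; have m2 := models_cutcon wf eS cS'.
  set q := fun x => omap (top S) (@fpar (funion a b) x).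
  have m1' : models (fun x => (x \in V) && (x \notin S)) q (cutcon V S).
    apply: models_eq m1 => // x /andP[xV _]; rewrite /q /restr.
    by case e: fpar => [p|//] /=; rewrite -(parV _ _ e) xV.
  have m2' : models (fun x => (x \in ~: V) && (x \notin S)) q (cutcon (~: V) S).
    apply: models_eq m2 => // x /andP[xV _]; rewrite /q /restr.
    by case e: fpar => [p|//] /=; rewrite inE -(parV _ _ e) -in_setC xV.
  apply: models_eq (models_funion m1' m2' _) => // x /=; rewrite [x \in ~: V]inE.
    by case: (x \in V); rewrite ?orbF.
  by case: (x \in V).
rewrite -Phi_sum_induced //.
have Gib a1 a2 : iso_invariant2 (fun b1 b2 => F (funion a1 b1) (funion a2 b2)).
  by move=> x x' y y' ix iy; apply: Fi; apply: iso_funion => //; apply: iso_refl.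
rewrite (Phi_sum_iso _ wa ia) => [|x x' y y' ix iy].
  by apply: eq_Phi_sum => a1 a2; apply: (Phi_sum_iso (Gib a1 a2) wb ib).
by apply: eq_Phi_sum => b1 b2; apply: Fi; apply: iso_funion => //; apply: iso_refl.
Qed.

Lemma Phi_sum_empty F : iso_invariant2 F ->
  Phi_sum empty_forest F = F empty_forest empty_forest.
Proof.
move=> Fi; have e0 (S : {set void}) : S = set0 by apply/setP => -[].
have vm (a : forest) : (fV a -> False) -> iso a empty_forest.
  move=> h; apply: (@models_iso _ pred0 (fun _ : void => None)) => //.
    by exists (fun x => match h x return void with end); split=> // x; case: (h x).
  by exists id; split=> // -[].
rewrite /Phi_sum (big_pred1 (set0 : {set fV empty_forest})) => [|S].
  by apply: Fi; apply: vm => -[[]].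
rewrite (e0 S) /= eqxx; apply/edge_setP => x; by rewrite inE.
Qed.

(** * Evaluation of formal combinations on invariant functions *)

Definition ev2 (v : vec2 k) (F : forest -> forest -> k) : k :=
  \sum_(c <- v) c.1 * F c.2.1 c.2.2.

Lemma eq_ev2 v F G : (forall a b, F a b = G a b) -> ev2 v F = ev2 v G.
Proof. by move=> FG; apply: eq_bigr => c _; rewrite FG. Qed.

Lemma ev2_mul v w F : ev2 (mul2 v w) F =
  ev2 v (fun a1 a2 => ev2 w (fun b1 b2 => F (funion a1 b1) (funion a2 b2))).
Proof.
rewrite /ev2 /mul2 big_allpairs_dep; apply: eq_bigr => a _; rewrite mulr_sumr.
by apply: eq_bigr => b _; rewrite mulrA.
Qed.

Lemma ev2_Phi_tree u F : acyc u -> iso_invariant2 F ->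
  ev2 (Phi_tree k u) F = Phi_sum u F.
Proof.
move=> wf Fi; rewrite -Phi_sum_subforest // /ev2 big_map big_enum /=.
by apply: eq_bigr => P _; rewrite mul1r.
Qed.

(** [Phi] is defined tree by tree, so [u] is replaced by the product of its components and
    multiplicativity peels off one tree at a time; [F] varies in the induction, as it absorbs the
    factors already removed. *)
Lemma ev2_Phi u F : acyc u -> iso_invariant2 F -> ev2 (Phi k u) F = Phi_sum u F.
Proof.
move=> wf Fi; have iu := iso_components wf; have wc := acyc_iso iu wf.
rewrite -(Phi_sum_iso Fi wf iu) /Phi; elim: (components u) wc F Fi {iu} => [|t L IH] wc F Fi.
  by rewrite /ev2 big_seq1 mul1r Phi_sum_empty.
have wt : acyc t by apply: (acyc_morph (h := inl : _ -> fV (Defs.fprod (t :: L))) _ wc) => x p /= ->.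
have wL : acyc (Defs.fprod L) 
  by apply: (acyc_morph (h := inr : _ -> fV (Defs.fprod (t :: L))) _ wc) => x p /= ->.
have Gi a1 a2 : iso_invariant2 (fun b1 b2 => F (funion a1 b1) (funion a2 b2)).
  by move=> x x' y y' ix iy; apply: Fi; apply: iso_funion => //; apply: iso_refl.
rewrite /= ev2_mul Phi_sum_funion // -ev2_Phi_tree // => [|x x' y y' ix iy].
  by apply: eq_ev2 => a1 a2; apply: IH.
by apply: eq_Phi_sum => b1 b2; apply: Fi; apply: iso_funion => //; apply: iso_refl.
Qed.

(** * Admissible cuts and contraction *)

Definition Delta_sum u (F : forest -> forest -> k) : k :=
  \sum_(V | @ck_adm u V) F (induced V) (induced (~: V)).

Lemma ev2_DeltaCK u F : ev2 (DeltaCK k u) F = Delta_sum u F.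
Proof.
rewrite /ev2 big_map big_enum /=.
by apply: eq_bigr => P _; rewrite mul1r.
Qed.

(** Admissibility can be tested on single edges: membership in [V] propagates from parent to child
    along a path. *)
Lemma ck_admP u (V : {set fV u}) :
  reflect (forall x p, fpar x = Some p -> p \in V -> x \in V) (ck_adm V).
Proof.
apply: (iffP forall_inP) => [h x p e pV|h v vV].
  apply: contraTT (pV) => xV; have /forall_inP/(_ x) := h p pV.
  rewrite inE xV anc_connect connect_parE e connect0 orbT andbT negbK => /(_ isT) /eqP px.
  by rewrite px.
apply/forall_inP => w; rewrite inE anc_connect negb_and => wV; apply/orP; right.
apply: contra wV => /connectP[s]; elim: s w => [w _ /= <-//|p s IH] w /= /andP[/eqP e ps] ev.
exact: (h _ _ e (IH _ ps ev)).
Qed.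

Lemma Delta_sum_iso a b F : iso_invariant2 F -> iso a b -> Delta_sum a F = Delta_sum b F.
Proof.
move=> Fi ab; have [f [g [fg gf fP]]] := iso_bij ab; have fi := can_inj fg.
pose h (S : {set fV a}) := g @^-1: S.
have hb : bijective h.
  by exists (fun S : {set fV b} => f @^-1: S) => S; apply/setP => x; rewrite !inE ?fg ?gf.
have hS S x : (f x \in h S) = (x \in S) by rewrite inE fg.
have hC S : ~: h S = h (~: S) by apply/setP => x; rewrite !inE.
have iI S : iso (induced S) (induced (h S)).
  apply: models_iso (models_induced _).
  apply: (models_inj fi (models_induced S)) => [x _|x|y]; rewrite ?hS //.
    rewrite /restr fP; case: fpar => [p|//] /=; rewrite hS; by case: ifP.
  by move=> yS; exists (g y); rewrite ?gf // -hS gf.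
rewrite /Delta_sum [RHS](reindex h); last exact: onW_bij.
apply: eq_big => [S|S _]; last by rewrite hC; apply: Fi.
apply/ck_admP/ck_admP => aS x p.
  rewrite -(gf x) -(gf p) fP !hS; case e: fpar => [q|//] [/fi qg]; rewrite -qg.
  exact: aS.
by move=> e; rewrite -!hS; apply: aS; rewrite fP e.
Qed.

Lemma par_conE u (S : {set fV u}) (z : fV (contract_edges S)) : acyc u -> edge_set S ->
  omap val (fpar z) = omap (top S) (fpar (val z)).
Proof.
move=> wf eS; have -> : fpar z = obind insub (omap (top S) (fpar (val z))) by [].
by case: (fpar (val z)) => [p|//] /=; rewrite insubT ?top_notin.
Qed.

Definition con_cut u (V S : {set fV u}) : {set fV (contract_edges S)} := [set z | val z \in V].

Lemma iso_con_cut u (V S : {set fV u}) : acyc u -> edge_set S -> compat V S ->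
  iso (induced (con_cut V S)) (cutcon V S).
Proof.
move=> wf eS cS; apply: models_iso (models_cutcon wf eS cS).
apply: (models_inj (j := val : fV (contract_edges S) -> fV u) val_inj (models_induced _)) => [z _|z|y].
- have := par_conE z wf eS; rewrite /restr.
  case: (fpar (val z)) (fpar z) => [p|] [w|] //= [e].
  rewrite inE (e : val w = _) compat_top //.
  by case: ifP => _ //=; congr Some.
- by rewrite inE => ->; rewrite (valP z).
by move=> /andP[yV yS]; exists (exist _ y yS); rewrite ?inE.
Qed.

(** Cuts of the contraction are pulled back to [u] along [top S]; this is the map [h] of the
    proof. *)
Lemma Delta_sum_con u (S : {set fV u}) F : acyc u -> edge_set S -> iso_invariant2 F ->
  Delta_sum (contract_edges S) F =
  \sum_(V | ck_adm V && compat V S) F (cutcon V S) (cutcon (~: V) S).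
Proof.
move=> wf eS Fi.
pose h (W : {set fV (contract_edges S)}) := [set x | [exists z in W, val z == top S x]].
have hE W x : (x \in h W) = [exists z in W, val z == top S x] by rewrite inE.
have topK (z : fV (contract_edges S)) : top S (val z) = val z by rewrite top_out // (valP z).
rewrite /Delta_sum (reindex_onto (fun V => con_cut V S) h) => [|W _]; last first.
  apply/setP => z; rewrite inE hE topK; apply/exists_inP/idP => [[w wW /eqP/val_inj <-//]|zW].
  by exists z.
have hcut V x : (x \in h (con_cut V S)) = (top S x \in V).
  rewrite hE; apply/exists_inP/idP => [[z + /eqP <-]|tV]; first by rewrite inE.
  by exists (exist (fun y => y \notin S) _ (top_notin x wf eS)); rewrite ?inE.
(* Restricting to component roots and pulling back recovers [V] exactly when [V] is a union of
   components of [S]. *)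
have hcompat V : (h (con_cut V S) == V) = compat V S.
  apply/eqP/idP => [hV|cS]; last by apply/setP => x; rewrite hcut compat_top.
  by apply/compatP => x p xS e; rewrite -hV !hcut (top_in wf eS xS e).
apply: eq_big => [V|V /andP[_]]; rewrite hcompat; last first.
  move=> cS; have -> : ~: con_cut V S = con_cut (~: V) S by apply/setP => z; rewrite !inE.
  by apply: Fi; apply: iso_con_cut; rewrite ?compatC.
have [cS|] := boolP (compat V S); rewrite ?andbF // !andbT.
have /compatP cS' := cS.
(* On edges of [S] the condition follows from compatibility; an edge outside [S] is an edge of the
   contraction, its lower end moved to [top]. *)
apply/ck_admP/ck_admP => aV x p e.
  move=> pV; have [xS|xS] := boolP (x \in S); first by rewrite (cS' _ _ xS e).
  pose z : fV (contract_edges S) := exist _ x xS.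
  have := par_conE z wf eS; rewrite [val z]/= e; case ez: (fpar z) => [w|//] [wE].
  by have := aV _ _ ez; rewrite !inE (wE : val w = _) compat_top //; apply.
have := par_conE x wf eS; rewrite e; case ex: (fpar (val x)) => [w|//] [wE].
by rewrite !inE => pV; apply: (aV _ _ ex); rewrite -(compat_top w wf eS cS) -wE.
Qed.
End Sums.

Theorem mainTheorem4 (k : fieldType) (hk : [pchar k]%R =i pred0)
    (u : forest) (hu : wf_forest u) (x : forest * forest * forest) :
  coef3 (lhs4 k u) x = coef3 (rhs4 k u) x.
Proof.
have wf := wf_acyc hu.
(* The indicator of the isomorphism class of [x]: evaluating it on either side yields the
   coefficient of [x]. *)
pose F a v w : k := (iso3 (a, v, w) x)%:R%R.
have Fi : iso_invariant3 F.
  move=> a a' b b' c c' ia ib ic.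
  by rewrite /F /iso3 /= (iso_congr _ ia) (iso_congr _ ib) (iso_congr _ ic).
have natif (r : k) (P : bool) : (if P then r else 0)%R = (r * P%:R)%R.
  by case: P; rewrite ?mulr1 ?mulr0.
transitivity (Phi_sum u (fun a b => Delta_sum b (F a))).
  rewrite -ev2_Phi // => [|a a' b b' ia ib]; last first.
    have Fa : iso_invariant2 (F a) by move=> c c' d d' ic id; apply: Fi => //; apply: iso_refl.
    rewrite (Delta_sum_iso Fa ib); apply: eq_bigr => V _.
    by apply: Fi => //; apply: iso_refl.
  rewrite /coef3 /lhs4 big_mkcond big_flatten big_map; apply: eq_bigr => c _.
  rewrite -ev2_DeltaCK big_map /ev2 mulr_sumr; apply: eq_bigr => d _ /=.
  by rewrite natif mulrA.
transitivity (Delta_sum u (fun v w =>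
    Phi_sum v (fun a1 a2 => Phi_sum w (fun b1 b2 => F (funion a1 b1) a2 b2)))).
  (* The common value: a sum over compatible pairs, indexed first by the edge set and, after the
     exchange, by the cut. *)
  transitivity (\sum_(S : {set fV u} | edge_set S)
      \sum_(V | ck_adm V && compat V S) F (edge_forest S) (cutcon V S) (cutcon (~: V) S))%R.
    apply: eq_bigr => S eS; apply: Delta_sum_con => // a a' b b' ia ib.
    by apply: Fi => //; apply: iso_refl.
  rewrite (exchange_big_dep (@ck_adm u)) => /= [|S V _ /andP[]//].
  apply: eq_bigr => V aV; rewrite Phi_sum_induced //.
  by apply: eq_bigl => S; rewrite aV.
rewrite /coef3 /rhs4 big_mkcond big_flatten big_map big_map big_enum /=.
apply: eq_bigr => V aV.
have wV := acyc_induced (B := V) wf; have wV' := acyc_induced (B := ~: V) wf.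
have Gi a1 a2 : iso_invariant2 (fun b1 b2 => F (funion a1 b1) a2 b2).
  by move=> c c' d d' ic id; apply: Fi => //; [apply: iso_funion => //|]; apply: iso_refl.
rewrite -ev2_Phi // => [|a a' b b' ia ib]; last first.
  apply: eq_bigr => S _; apply: Fi => //; last exact: iso_refl.
  by apply: iso_funion => //; apply: iso_refl.
rewrite big_allpairs_dep; apply: eq_bigr => a _.
rewrite -ev2_Phi // /ev2 mulr_sumr; apply: eq_bigr => b _ /=.
by rewrite natif mul1r mulrA.
Qed.
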